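(* Let $\mathcal X=\mathbb Z_{\ge0}$, $a_1,b_1,a_2>0$, $0<b_2<1$, and define for $x,y\in\mathcal X$ $$K(x,y)=\sum_{z_2=0}^{\min(x,y)}\pi_H(z_2,y,a_1,b_1)\sum_{z_1=\max(x,y)}^{\infty}\pi_H(x-z_2,z_1-z_2,b_1,a_2)\,\pi_M(z_1-y,a_2,b_2).$$ Then $K(x,y)\ge0$, $\sum_{x\in\mathcal X}K(x,y)=1$, and with $\lambda=(a_1+b_1,b_2)$ one has, for all $x,y,n\in\mathcal X$, $$K(x,y)\,\pi_M(y,\lambda)=K(y,x)\,\pi_M(x,\lambda),$$ $$\sum_{y\in\mathcal X}K(x,y)\,\pi_M(y,\lambda)\,\check P_{M,n}(y,\lambda)=\kappa(n)\,\pi_M(x,\lambda)\,\check P_{M,n}(x,\lambda),$$ with $$\kappa(n)=\sum_{k=0}^n\frac{(-n)_k(b_1)_k(a_2)_k}{(a_1+b_1)_k(b_1+a_2)_k\,k!}.$$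
   Context: $(a)_n=a(a+1)\cdots(a+n-1)$. Hahn measure ($a,b>0$, integers $0\le x\le M$): $\pi_H(x,M,a,b)=\binom Mx\frac{(a)_x(b)_{M-x}}{(a+b)_M}$. Meixner measure ($a>0$, $0<b<1$, $x\in\mathbb Z_{\ge0}$): $\pi_M(x,a,b)=\frac{(a)_x\,b^x(1-b)^a}{x!}$. Meixner polynomials: $\check P_{M,n}(x,a,b)=\sum_{k=0}^n\frac{(-n)_k(-x)_k}{(a)_k\,k!}(1-b^{-1})^k$. *)

(* Defs.v *)
From HB Require Import structures.
From mathcomp Require Export all_boot all_order all_algebra.
From mathcomp Require Export all_classical all_reals all_analysis.
Export Order.TTheory GRing.Theory Num.Theory.
Export numFieldNormedType.Exports.

Set Implicit Arguments.
Unset Strict Implicit.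
Unset Printing Implicit Defensive.

Local Open Scope classical_set_scope.
Local Open Scope ring_scope.

Definition poch (R : realType) (a : R) (n : nat) : R :=
  \prod_(i < n) (a + i%:R).

(* Only meant for x <= M (the natural subtraction M - x is then exact); outside
   that range the value is 0, because 'C(M, x) = 0. *)
Definition hahn_measure (R : realType) (x M : nat) (a b : R) : R :=
  'C(M, x)%:R * (poch a x * poch b (M - x) / poch (a + b) M).

Definition meixner_measure (R : realType) (x : nat) (a b : R) : R :=
  poch a x * b ^+ x * (1 - b) `^ a / x`!%:R.

Definition meixner_poly (R : realType) (n x : nat) (a b : R) : R :=
  \sum_(0 <= k < n.+1)
    poch (- n%:R) k * poch (- x%:R) k / (poch a k * k`!%:R) * (1 - b^-1) ^+ k.

(* kernelK takes limn of this sequence. limn is a total operator, so convergence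
   of these partial sums is to be asserted separately. For z2 <= min(x, y) and
   z1 >= max(x, y) all the natural subtractions are exact. *)
Definition inner_psum (R : realType) (b1 a2 b2 : R) (x y z2 N : nat) : R :=
  \sum_(maxn x y <= z1 < N)
    hahn_measure (x - z2) (z1 - z2) b1 a2 * meixner_measure (z1 - y) a2 b2.

Definition kernelK (R : realType) (a1 b1 a2 b2 : R) (x y : nat) : R :=
  \sum_(0 <= z2 < (minn x y).+1)
    hahn_measure z2 y a1 b1 * limn (inner_psum b1 a2 b2 x y z2).

Definition kappa (R : realType) (a1 b1 a2 : R) (n : nat) : R :=
  \sum_(0 <= k < n.+1)
    poch (- n%:R) k * poch b1 k * poch a2 k /
    (poch (a1 + b1) k * poch (b1 + a2) k * k`!%:R).

(* Main.v *)
Require Import Defs.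
From mathcomp Require Import ring zify.
Set Implicit Arguments.
Unset Strict Implicit.
Unset Printing Implicit Defensive.
Local Open Scope classical_set_scope.
Local Open Scope ring_scope.

(** Write [y = z + u], where [z] is drawn from the Hahn measure on [0..x], the
rest is [w = x - z], an independent negative binomial [v = z1 - x] is added, and
[u] is drawn from the Hahn measure on [0..w + v]. Since the product of the laws
of [w] and [v] is the law of [w + v] times a Hahn measure, the weight of a pair
[(x, y)] is symmetric, which is detailed balance.

For the spectrum, let [Q_n^a = (a)_n / n! P_n^a], whose generating function
[(1 - t/b)^y (1 - t)^(- y - a)] gives
[Q_n^(a1+b1)(z + u) = sum_j Q_(n-j)^a1(z) Q_j^b1(u)]. The Hahn mean over [u] turns
[Q_j^b1(u)] into [(b1)_j / (b1+a2)_j Q_j^(b1+a2)(w + v)], the mean over [v] turns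
this into a multiple of [Q_j^b1(w)], and the Hahn mean over [z] of
[Q_(n-j)^a1(z) Q_j^b1(x - z)] is a multiple of [P_n(x)]. The eigenvalue is thus
[sum_j binom(n, j) (a1)_(n-j) (b1)_j / (a1+b1)_n * (b1)_j / (b1+a2)_j], which
equals [kappa n] by Chu-Vandermonde. The total mass is the case [n = 0]. *)

(* The coefficient of [t^n] in [(1 - t)^(- a)]. *)
Definition rb (R : realType) (a : R) (n : nat) : R := poch a n / n`!%:R.

(** * Pochhammer coefficients and their convolutions *)

Section Pochhammer.
Context {R : realType}.
Implicit Types (a b c : R) (m n i j k l : nat).

Lemma fact_neq0 n : n`!%:R != 0 :> R.
Proof. by rewrite pnatr_eq0 -lt0n fact_gt0. Qed.

Lemma poch0 a : poch a 0 = 1.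
Proof. by rewrite /poch big_ord0. Qed.

Lemma pochS a n : poch a n.+1 = poch a n * (a + n%:R).
Proof. by rewrite /poch big_ord_recr. Qed.

Lemma pochD a m n : poch a (m + n) = poch a m * poch (a + m%:R) n.
Proof.
elim: n => [|n IH]; first by rewrite addn0 poch0 mulr1.
by rewrite addnS !pochS IH natrD mulrA addrA.
Qed.

Lemma poch_gt0 a n : 0 < a -> 0 < poch a n.
Proof. by move=> a0; apply: prodr_gt0 => i _; rewrite ltr_wpDr. Qed.

Lemma poch_opp_nat n k : poch (- n%:R : R) k = (-1) ^+ k * (n ^_ k)%:R.
Proof.
elim: k => [|k IH]; first by rewrite poch0 ffactn0 mulr1.
rewrite pochS IH ffactnSr exprS natrM.
have [kn|nk] := leqP k n; last by rewrite ffact_small // !(mul0r, mulr0).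
by rewrite natrB //; ring.
Qed.

Lemma rb0 a : rb a 0 = 1.
Proof. by rewrite /rb poch0 fact0 divr1. Qed.

Lemma rbS a n : n.+1%:R * rb a n.+1 = (a + n%:R) * rb a n.
Proof.
rewrite /rb pochS factS natrM; field.
by rewrite fact_neq0 addrC natr1 pnatr_eq0.
Qed.

Lemma rb_gt0 a n : 0 < a -> 0 < rb a n.
Proof. by move=> a0; rewrite divr_gt0 ?poch_gt0// ltr0n fact_gt0. Qed.

Lemma rb_ge0 a n : 0 < a -> 0 <= rb a n.
Proof. by move=> a0; exact/ltW/rb_gt0. Qed.

Lemma rb_neq0 a n : 0 < a -> rb a n != 0.
Proof. by move=> a0; rewrite gt_eqF ?rb_gt0. Qed.

(** [(a)_n] splits as [(a)_k (a + k)_(n-k)]; this absorbs a binomial into a weight by shifting its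
    parameter. *)
Lemma rb_bin a n k : (k <= n)%N ->
  rb a n * 'C(n, k)%:R = rb a k * rb (a + k%:R) (n - k).
Proof.
move=> kn; rewrite /rb -[in poch a n](subnKC kn) pochD.
rewrite -(bin_fact kn) !natrM; field.
by rewrite !fact_neq0 pnatr_eq0 -lt0n bin_gt0.
Qed.

Lemma rbS_shift a n : n.+1%:R * rb a n.+1 = a * rb (a + 1) n.
Proof.
rewrite /rb -[in poch a _]add1n pochD pochS poch0 factS natrM; field.
by rewrite fact_neq0 addrC natr1 pnatr_eq0.
Qed.

(** Coefficients in [(1 - t)^(- a - 1) = (1 - t)^(- a) + t (1 - t)^(- a - 1)]. *)
Lemma rb_addr1 a n : rb (a + 1) n.+1 = rb a n.+1 + rb (a + 1) n.
Proof.
have n0 : n.+1%:R != 0 :> R by rewrite pnatr_eq0.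
apply: (mulfI n0); rewrite mulrDr rbS rbS_shift.
by rewrite -natr1; ring.
Qed.

(* Multiplying by [n + 1 = i + (n + 1 - i)] turns the recurrences [rbS] of
   the two factors into the one of the convolution. *)
Lemma rbD a b n : rb (a + b) n = \sum_(i < n.+1) rb a i * rb b (n - i).
Proof.
elim: n => [|n IH]; first by rewrite big_ord1 !rb0 mulr1.
have n0 : n.+1%:R != 0 :> R by rewrite pnatr_eq0.
apply: (mulfI n0); rewrite rbS IH !mulr_sumr.
have -> : \sum_(i < n.+2) n.+1%:R * (rb a i * rb b (n.+1 - i)) =
  \sum_(i < n.+2) i%:R * rb a i * rb b (n.+1 - i) +
  \sum_(i < n.+2) rb a i * ((n.+1 - i)%:R * rb b (n.+1 - i)).
  rewrite -big_split; apply: eq_bigr => i _ /=.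
  by rewrite natrB -1?ltnS //; ring.
rewrite [X in _ = X + _]big_ord_recl !mul0r add0r [X in _ = _ + X]big_ord_recr /= subnn.
rewrite mul0r mulr0 addr0 -big_split; apply: eq_bigr => i _ /=.
have ile : (i <= n)%N by rewrite -ltnS.
by rewrite /bump add1n subSS subSn // !rbS natrB //; ring.
Qed.

Lemma rb_reflect a n : rb a n = (-1) ^+ n * rb (1 - a - n%:R) n.
Proof.
rewrite /rb mulrA; congr (_ / _); rewrite /poch.
rewrite -[X in (-1) ^+ X]card_ord -prodr_const -big_split /=.
rewrite (reindex_inj rev_ord_inj) /=; apply: eq_bigr => i _.
by rewrite natrB // -natr1; ring.
Qed.

(* Reflection turns this into [rbD]. *)
Lemma rb_sub a c n : rb c n =
  \sum_(k < n.+1) (-1) ^+ k * rb a k * rb (c + a + k%:R) (n - k).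
Proof.
rewrite rb_reflect.
have -> : 1 - c - n%:R = a + (1 - c - a - n%:R) by ring.
rewrite rbD mulr_sumr; apply: eq_bigr => k _.
have kn : (k <= n)%N by rewrite -ltnS.
rewrite [rb (c + _ + _) _]rb_reflect natrB //.
have -> : 1 - (c + a + k%:R) - (n%:R - k%:R) = 1 - c - a - n%:R by ring.
have -> : (-1 : R) ^+ n = (-1) ^+ k * (-1) ^+ (n - k).
  by rewrite -exprD subnKC.
ring.
Qed.

End Pochhammer.

(** * Hahn means of binomials *)

Section HahnAverage.
Context {R : realType}.
Implicit Types (a b c : R) (f g : nat -> R) (m n i j k l : nat).

(** The weights are quotients of [rb], so that sums over [z] are convolutions governed by [rbD]. *)
Definition hahn_avg a b n f : R :=
  \sum_(z < n.+1) rb a z * rb b (n - z) / rb (a + b) n * f z.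

Lemma hahn_measureE a b z n : 0 < a -> 0 < b -> (z <= n)%N ->
  hahn_measure z n a b = rb a z * rb b (n - z) / rb (a + b) n.
Proof.
move=> a0 b0 zn; rewrite /hahn_measure /rb -(bin_fact zn) !natrM; field.
rewrite !fact_neq0 pnatr_eq0 -lt0n bin_gt0 zn /=.
by rewrite gt_eqF // poch_gt0 // addr_gt0.
Qed.

Lemma eq_hahn_avg a b n f g : (forall z, (z <= n)%N -> f z = g z) ->
  hahn_avg a b n f = hahn_avg a b n g.
Proof. by move=> fg; apply: eq_bigr => z _; rewrite fg // -ltnS. Qed.

Lemma hahn_avgZ a b n c f :
  hahn_avg a b n (fun z => c * f z) = c * hahn_avg a b n f.
Proof. by rewrite /hahn_avg mulr_sumr; apply: eq_bigr => z _; rewrite mulrCA. Qed.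

Lemma hahn_avg_sum a b n m (F : 'I_m -> nat -> R) :
  hahn_avg a b n (fun z => \sum_(k < m) F k z) =
  \sum_(k < m) hahn_avg a b n (F k).
Proof.
rewrite /hahn_avg exchange_big; apply: eq_bigr => z _.
by rewrite mulr_sumr.
Qed.

Lemma sum_shift_conv f g n i l : (i + l <= n)%N ->
  \sum_(z < n.+1 | (i <= z)%N && (z + l <= n)%N) f (z - i)%N * g (n - z - l)%N =
  \sum_(k < (n - i - l).+1) f k * g (n - i - l - k)%N.
Proof.
move=> iln.
rewrite -(big_mkord (fun z => (i <= z)%N && (z + l <= n)%N)
  (fun z => f (z - i)%N * g (n - z - l)%N)).
rewrite -(big_mkord xpredT (fun k => f k * g (n - i - l - k)%N)).
have il : (i <= (n - l).+1)%N by lia.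
rewrite (@big_cat_nat _ _ _ i) //=; last by lia.
rewrite big1_seq ?add0r; last first.
  by move=> z /andP[/andP[iz _]]; rewrite mem_index_iota; lia.
rewrite (@big_cat_nat _ _ _ (n - l).+1) //=; last by lia.
rewrite [X in _ + X]big1_seq ?addr0; last first.
  by move=> z /andP[/andP[_ zl]]; rewrite mem_index_iota; lia.
rewrite -{1}[i]add0n big_addn.
have -> : ((n - l).+1 - i = (n - i - l).+1)%N by lia.
rewrite big_nat_cond [RHS]big_nat_cond.
apply: eq_big => [z|z /andP[/andP[_ zl] _]]; first by lia.
congr (f _ * g _); lia.
Qed.

(** [rb_bin] absorbs both binomials by shifting [a] to [a + i] and [b] to [b + l]; [rbD] convolves
    the shifted weights, and [rb_bin] for [a + b] undoes the shift. *)
Lemma hahn_avg_bin a b n i l : 0 < a -> 0 < b ->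
  hahn_avg a b n (fun z => 'C(z, i)%:R * 'C(n - z, l)%:R) =
  rb a i * rb b l / rb (a + b) (i + l) * 'C(n, i + l)%:R.
Proof.
move=> a0 b0; have ab0 := addr_gt0 a0 b0.
rewrite /hahn_avg.
(* Unless [i <= z] and [z + l <= n], one of the binomials vanishes. *)
rewrite (bigID (fun z : 'I_n.+1 => (i <= z)%N && (z + l <= n)%N)) /= [X in _ + X]big1 ?addr0; last first.
  move=> z /nandP[iz|zl]; first by rewrite bin_small ?mul0r ?mulr0 //; lia.
  have zn := ltn_ord z.
  have [lz|?] := ltnP (n - z) l; first by rewrite (bin_small lz) !mulr0.
  by exfalso; lia.
have [iln|nil] := leqP (i + l) n; last first.
  rewrite bin_small // mulr0 big_pred0 // => z.
  by apply/negP => /andP[]; lia.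
transitivity (\sum_(z < n.+1 | (i <= z)%N && (z + l <= n)%N)
   (rb a i * rb b l / rb (a + b) n) *
   (rb (a + i%:R) (z - i) * rb (b + l%:R) (n - z - l))).
  apply: eq_bigr => z /andP[iz zl].
  have lz : (l <= n - z)%N by lia.
  rewrite [LHS](_ : _ = (rb a z * 'C(z, i)%:R) * (rb b (n - z) * 'C(n - z, l)%:R) / rb (a + b) n); last by ring.
  by rewrite !rb_bin //; ring.
rewrite -mulr_sumr (@sum_shift_conv (rb (a + i%:R)) (rb (b + l%:R))) // -rbD -subnDA.
have -> : a + i%:R + (b + l%:R) = a + b + (i + l)%:R by rewrite natrD; ring.
have := rb_bin (a + b) iln.
rewrite [X in X = _]mulrC => /(congr1 (fun x => x / rb (a + b) n)).
rewrite mulfK ?rb_neq0 // => ->.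
by field; rewrite !rb_neq0.
Qed.

Lemma hahn_avg_bin1 a b n k : 0 < a -> 0 < b ->
  hahn_avg a b n (fun z => 'C(z, k)%:R) =
  rb a k / rb (a + b) k * 'C(n, k)%:R.
Proof.
move=> a0 b0; have := @hahn_avg_bin a b n k 0 a0 b0.
rewrite rb0 mulr1 addn0 => <-.
by apply: eq_hahn_avg => z _; rewrite bin0 mulr1.
Qed.

Lemma hahn_measure_ge0 z n a c : 0 < a -> 0 < c -> 0 <= hahn_measure z n a c :> R.
Proof.
move=> a0 c0; rewrite mulr_ge0 // divr_ge0 ?mulr_ge0 //; apply/ltW/poch_gt0 => //.
exact: addr_gt0.
Qed.

Lemma hahn_measure_le1 z n a c : 0 < a -> 0 < c -> hahn_measure z n a c <= 1 :> R.
Proof.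
move=> a0 c0; have [zn|nz] := leqP z n; last by rewrite /hahn_measure bin_small // mul0r.
have := hahn_avg_bin1 n 0 a0 c0.
rewrite !bin0 !rb0 divr1 mulr1 => <-.
have zn' : (z < n.+1)%N by [].
rewrite /hahn_avg (bigD1 (Ordinal zn')) //= bin0 mulr1 -hahn_measureE // lerDl.
apply: sumr_ge0 => i _; rewrite bin0 mulr1 -hahn_measureE -1?ltnS //.
exact: hahn_measure_ge0.
Qed.

Lemma hahn_avgE a c n f : 0 < a -> 0 < c ->
  hahn_avg a c n f = \sum_(0 <= z < n.+1) hahn_measure z n a c * f z.
Proof.
move=> a0 c0; rewrite big_mkord; apply: eq_bigr => z _.
by rewrite hahn_measureE // -ltnS.
Qed.

Lemma bin_add m n k :
  'C(m + n, k)%:R = \sum_(i < k.+1) 'C(m, i)%:R * 'C(n, k - i)%:R :> R.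
Proof.
by rewrite -binomial.Vandermonde natr_sum; apply: eq_bigr => i _; rewrite natrM.
Qed.

(** With [f k = t^k] this is [(1 + t)^(m+n) = (1 + t)^m (1 + t)^n]; in the induction, a factor
    [1 + t] turns [f k] into [f k + f k.+1]. *)
Lemma sum_bin_add f m n :
  \sum_(k < (m + n).+1) 'C(m + n, k)%:R * f k =
  \sum_(i < m.+1) \sum_(j < n.+1) 'C(m, i)%:R * 'C(n, j)%:R * f (i + j)%N.
Proof.
elim: m f => [|m IH] f.
  rewrite big_ord1; apply: eq_bigr => j _.
  by rewrite bin0 mul1r.
transitivity (\sum_(k < (m + n).+1) 'C(m + n, k)%:R * (f k + f k.+1)).
  rewrite addSn big_ord_recl /= bin0.
  under eq_bigr => i _ do rewrite /bump ?add1n binS natrD mulrDl.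
  rewrite big_split /= big_ord_recr /= bin_small // mul0r addr0.
  under [RHS]eq_bigr => i _ do rewrite mulrDr.
  by rewrite big_split /= addrA [in RHS]big_ord_recl /= bin0.
rewrite (IH (fun k => f k + f k.+1)).
under eq_bigr => i _ do (under eq_bigr => j _ do rewrite mulrDr; rewrite big_split /=).
rewrite big_split /= [in RHS]big_ord_recl /= bin0 [X in X + _ = _]big_ord_recl /= bin0 -!addrA.
congr (_ + _).
under [RHS]eq_bigr => i _ do
  (under eq_bigr => j _ do rewrite /bump ?add1n binS natrD !mulrDl addSn; rewrite big_split /=).
rewrite big_split /=; congr (_ + _).
by rewrite [RHS]big_ord_recr /= [X in _ + X]big1 ?addr0 // => j _; rewrite bin_small // !mul0r.
Qed.

End HahnAverage.

(** * Meixner polynomials under Hahn means, and the eigenvalue *)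

Section MeixnerPolynomials.
Context {R : realType}.
Implicit Types (a b c : R) (f g : nat -> R) (m n i j k l x y z u : nat).

(* [(a)_n / n!] times the Meixner polynomial, with [c = 1/b - 1]: the
   coefficient of [t^n] in [(1 - t/b)^y (1 - t)^(- y - a)]. *)
Definition meixner_scaled c a n y : R :=
  \sum_(k < n.+1) (- c) ^+ k * 'C(y, k)%:R * rb (a + k%:R) (n - k).

Lemma meixner_polyE n x a b : 0 < a ->
  meixner_poly n x a b =
  \sum_(k < n.+1) 'C(n, k)%:R * (1 - b^-1) ^+ k * 'C(x, k)%:R / rb a k.
Proof.
move=> a0; rewrite /meixner_poly big_mkord; apply: eq_bigr => k _.
rewrite !poch_opp_nat /rb -!bin_ffact !natrM mulrACA -exprMn mulrNN mulr1 expr1n.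
by field; rewrite fact_neq0 gt_eqF // poch_gt0.
Qed.

Lemma meixner_scaledE a b n x : 0 < a ->
  meixner_scaled (b^-1 - 1) a n x = rb a n * meixner_poly n x a b.
Proof.
move=> a0; rewrite meixner_polyE // mulr_sumr; apply: eq_bigr => k _.
have kn : (k <= n)%N by rewrite -ltnS.
rewrite opprB -[rb (a + _) _](mulKf (rb_neq0 k a0)) -rb_bin //; ring.
Qed.

Lemma meixner_scaled0 c a y : meixner_scaled c a 0 y = 1.
Proof. by rewrite /meixner_scaled big_ord1 bin0 rb0 !mulr1. Qed.

Lemma meixner_scaledn0 c a n : meixner_scaled c a n 0 = rb a n.
Proof.
rewrite /meixner_scaled big_ord_recl big1 ?addr0 => [|i _].
  by rewrite bin0 /= subn0 expr0 !mul1r.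
by rewrite bin0n mulr0 mul0r.
Qed.

(** Pascal's rule in [y]; on generating functions, [(1 - t/b) / (1 - t) = 1 - c t / (1 - t)]. *)
Lemma meixner_scaledS c a n y : meixner_scaled c a n.+1 y.+1 =
  meixner_scaled c a n.+1 y - c * meixner_scaled c (a + 1) n y.
Proof.
rewrite /meixner_scaled big_ord_recl [in RHS]big_ord_recl /= !bin0.
rewrite mulr_sumr -addrA -sumrB; congr (_ + _); apply: eq_bigr => i _.
rewrite /bump add1n binS natrD exprS subSS.
have -> : a + i.+1%:R = a + 1 + i%:R by rewrite -natr1; ring.
ring.
Qed.

(** The generating functions multiply. The induction, on [z] and then on [y], uses
    [meixner_scaledS]; the base case is [rbD]. *)
Lemma meixner_scaledD c a b n y z : meixner_scaled c (a + b) n (y + z) =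
  \sum_(j < n.+1) meixner_scaled c a (n - j) y * meixner_scaled c b j z.
Proof.
elim: z b n => [|z IH] b n; last first.
  rewrite addnS; case: n => [|n].
    by rewrite big_ord1 !meixner_scaled0 mulr1.
  rewrite meixner_scaledS -(addrA a b 1) !IH [in RHS]big_ord_recl [X in X - _ = _]big_ord_recl.
  rewrite !meixner_scaled0 -addrA; congr (_ + _).
  rewrite mulr_sumr -sumrB; apply: eq_bigr => j _.
  by rewrite lift0 subSS meixner_scaledS; ring.
elim: y a n => [|y IH] a n.
  rewrite addn0 meixner_scaledn0 addrC rbD; apply: eq_bigr => j _.
  by rewrite !meixner_scaledn0 mulrC.
rewrite addSn; case: n => [|n].
  by rewrite big_ord1 !meixner_scaled0 mulr1.
rewrite meixner_scaledS (addrAC a b 1) !IH [in RHS]big_ord_recr [X in X - _ = _]big_ord_recr /=.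
rewrite ?subnn !meixner_scaled0 addrAC; congr (_ + _).
rewrite mulr_sumr -sumrB; apply: eq_bigr => j _.
by rewrite subSn -1?ltnS // meixner_scaledS; ring.
Qed.

(** Each binomial in [z] averages to [rb a k / rb (a + b) k] times the one in [n]; by [rb_bin] for
    [a] and [a + b], the ratio of the two sides' coefficients does not depend on [k]. *)
Lemma hahn_avg_meixner_scaled c a b n j : 0 < a -> 0 < b ->
  hahn_avg a b n (meixner_scaled c a j) =
  rb a j / rb (a + b) j * meixner_scaled c (a + b) j n.
Proof.
move=> a0 b0; have ab0 := addr_gt0 a0 b0.
rewrite /meixner_scaled hahn_avg_sum mulr_sumr; apply: eq_bigr => k _.
have kj : (k <= j)%N by rewrite -ltnS.
transitivity ((- c) ^+ k * rb (a + k%:R) (j - k) *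
  hahn_avg a b n (fun z => 'C(z, k)%:R)).
  by rewrite -hahn_avgZ; apply: eq_hahn_avg => z _; ring.
rewrite hahn_avg_bin1 //.
have := rb_bin a kj; have := rb_bin (a + b) kj.
have [? ? ?] := And3 (rb_neq0 k ab0) (rb_neq0 j ab0) (rb_neq0 j a0).
set X := rb (a + k%:R) _; set Y := rb (a + b + k%:R) _ => eY eX.
have -> : Y = rb (a + b) j * 'C(j, k)%:R / rb (a + b) k by rewrite eY; field.
transitivity ((- c) ^+ k * (rb a k * X) / rb (a + b) k * 'C(n, k)%:R).
  by field.
by rewrite -eX; field; apply/andP.
Qed.

(* The mean of [binom(z, i) binom(x - z, l)], divided by [rb a1 i * rb b1 l], only
   depends on [i + l]; so the claim reduces to
   [(1 - t)^(n-j) (1 - t)^j = (1 - t)^n]. *)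
Lemma hahn_avg_meixner2 b n j a1 b1 x : 0 < a1 -> 0 < b1 -> (j <= n)%N ->
  hahn_avg a1 b1 x (fun z =>
    meixner_scaled (b^-1 - 1) a1 (n - j) z *
    meixner_scaled (b^-1 - 1) b1 j (x - z)) =
  rb a1 (n - j) * rb b1 j * meixner_poly n x (a1 + b1) b.
Proof.
move=> a10 b10 jn; have ab0 := addr_gt0 a10 b10.
set r := - (b^-1 - 1).
have shift k : rb (a1 + b1) k != 0 by exact: rb_neq0.
transitivity (\sum_(i < (n - j).+1) \sum_(l < j.+1)
   rb a1 (n - j) * rb b1 j * ('C(n - j, i)%:R * 'C(j, l)%:R *
   (r ^+ (i + l) * 'C(x, i + l)%:R / rb (a1 + b1) (i + l)))).
  under eq_hahn_avg => z _ do rewrite /meixner_scaled big_distrlr /=.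
  rewrite hahn_avg_sum; apply: eq_bigr => i _.
  rewrite hahn_avg_sum; apply: eq_bigr => l _.
  have inj : (i <= n - j)%N by rewrite -ltnS.
  have lj : (l <= j)%N by rewrite -ltnS.
  transitivity (r ^+ (i + l) * rb (a1 + i%:R) (n - j - i) *
     rb (b1 + l%:R) (j - l) *
     hahn_avg a1 b1 x (fun z => 'C(z, i)%:R * 'C(x - z, l)%:R)).
    by rewrite -hahn_avgZ; apply: eq_hahn_avg => z _; rewrite exprD; ring.
  rewrite hahn_avg_bin //.
  transitivity (r ^+ (i + l) * (rb a1 (n - j) * 'C(n - j, i)%:R) *
     (rb b1 j * 'C(j, l)%:R) / rb (a1 + b1) (i + l) * 'C(x, i + l)%:R).
    by rewrite !rb_bin //; field.
  by field.
rewrite meixner_polyE // mulr_sumr.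
pose h k : R := r ^+ k * 'C(x, k)%:R / rb (a1 + b1) k.
have -> : \sum_(k < n.+1) rb a1 (n - j) * rb b1 j *
     ('C(n, k)%:R * (1 - b^-1) ^+ k * 'C(x, k)%:R / rb (a1 + b1) k) =
   rb a1 (n - j) * rb b1 j * \sum_(k < n.+1) 'C(n, k)%:R * h k.
  rewrite mulr_sumr; apply: eq_bigr => k _.
  by rewrite /h /r opprB; ring.
have := sum_bin_add h (n - j) j; rewrite subnK // => ->; rewrite mulr_sumr.
apply: eq_bigr => i _; rewrite mulr_sumr; apply: eq_bigr => l _.
by rewrite /h; ring.
Qed.

(** By [rb_sub], [(b1)_j / (b1+a2)_j] is an alternating combination of the binomials ['C(j, m)], and
    the sum over [j] of each is a Hahn mean. *)
Lemma kappaE a1 b1 a2 n : 0 < a1 -> 0 < b1 -> 0 < a2 ->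
  \sum_(j < n.+1) rb a1 (n - j) * rb b1 j * (rb b1 j / rb (b1 + a2) j) =
  rb (a1 + b1) n * kappa a1 b1 a2 n.
Proof.
move=> a10 b10 a20; have ab0 := addr_gt0 a10 b10; have ba0 := addr_gt0 b10 a20.
transitivity (\sum_(j < n.+1) \sum_(m < n.+1)
    (-1) ^+ m * rb a2 m / rb (b1 + a2) m *
    (rb a1 (n - j) * rb b1 j * 'C(j, m)%:R)).
  apply: eq_bigr => j _.
  have jn : (j < n.+1)%N by [].
  rewrite [X in _ * (X / _)](rb_sub a2) mulr_suml mulr_sumr.
  (* Binomials with [m > j] vanish, so [m] can run up to [n] for every [j] and the sums can be
     exchanged. *)
  rewrite [RHS](bigID (fun m : 'I_n.+1 => (m < j.+1)%N)) /=.
  rewrite [X in _ = _ + X]big1 ?addr0; last first.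
    by move=> m; rewrite -leqNgt => jm; rewrite bin_small // !mulr0.
  rewrite (big_ord_widen_cond _ xpredT (fun m => rb a1 (n - j) * rb b1 j *
    ((-1) ^+ m * rb a2 m * rb (b1 + a2 + m%:R) (j - m) / rb (b1 + a2) j)) jn) /=.
  apply: eq_bigr => m; rewrite ltnS => mj.
  have -> : rb (b1 + a2 + m%:R) (j - m) = rb (b1 + a2) j * 'C(j, m)%:R / rb (b1 + a2) m.
    by rewrite rb_bin // mulrAC mulfV ?mul1r // rb_neq0.
  by field; rewrite !rb_neq0.
rewrite exchange_big /kappa big_mkord mulr_sumr; apply: eq_bigr => m _ /=.
have mn : (m <= n)%N by rewrite -ltnS.
rewrite -mulr_sumr.
transitivity ((-1) ^+ m * rb a2 m / rb (b1 + a2) m * (rb (b1 + a1) n *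
    hahn_avg b1 a1 n (fun j => 'C(j, m)%:R))).
  congr (_ * _); rewrite /hahn_avg mulr_sumr; apply: eq_bigr => j _.
  by field; rewrite rb_neq0 // addrC.
rewrite hahn_avg_bin1 // (addrC b1 a1) poch_opp_nat -bin_ffact natrM /rb.
field.
by rewrite !fact_neq0 !gt_eqF // poch_gt0.
Qed.

End MeixnerPolynomials.

(** * The binomial series of [(1 - x)^(- a)] *)

Section BinomialSeries.
Context {R : realType}.
Implicit Types (a b x : R) (n m k : nat).

(** The identity [(1 - x)^(- a) = (1 - x) (1 - x)^(- a - 1)], truncated, with its boundary term. *)
Lemma pseries_rb_telescope a x n :
  \sum_(0 <= i < n.+1) rb a i * x ^+ i =
  (1 - x) * \sum_(0 <= i < n.+1) rb (a + 1) i * x ^+ i + x ^+ n.+1 * rb (a + 1) n.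
Proof.
elim: n => [|n IH]; first by rewrite !big_nat1 !rb0; ring.
rewrite big_nat_recr //= IH [in RHS]big_nat_recr //= rb_addr1 !exprS; ring.
Qed.

Lemma rb_le1 a n : 0 < a -> a <= 1 -> rb a n <= 1.
Proof.
move=> a0 a1; elim: n => [|n IH]; first by rewrite rb0.
rewrite -(ler_pM2l (ltr0Sn R n)) rbS mulr1 -(mulr1 n.+1%:R).
rewrite ler_pM ?rb_ge0 //; first by rewrite addr_ge0 // ltW.
by rewrite -natr1 addrC lerD2l.
Qed.

(** Induction on an integer bound of [a]: the geometric series dominates when [a <= 1], and a larger
    [a] reduces to [a - 1] by telescoping. *)
Lemma is_cvg_pseries_rb a x : 0 < a -> 0 <= x -> x < 1 -> cvgn (pseries (rb a) x).
Proof.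
move=> a0 x0 x1.
have [m am] : exists m, a <= m.+1%:R.
  exists (Num.bound a); apply: ltW; apply: lt_trans (archi_boundP (ltW a0)) _.
  by rewrite ltr_nat.
elim: m a a0 am => [|m IH] a a0 am.
  apply: (@series_le_cvg _ _ (geometric 1 x)) => [n|n|n|].
  - by rewrite mulr_ge0 ?rb_ge0 // exprn_ge0.
  - by rewrite /= mul1r exprn_ge0.
  - by rewrite /= ler_wpM2r ?exprn_ge0 // rb_le1.
  - by apply: is_cvg_geometric_series; rewrite ger0_norm.
have [a1|a1] := leP a 1.
  by apply: IH => //; rewrite (le_trans a1) // ler1n.
have c1 : cvgn (pseries (rb (a - 1)) x).
  by apply: IH; rewrite ?subr_gt0 // lerBlDr natr1.
have nn b : 0 < b -> nondecreasing_seq (pseries (rb b) x).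
  move=> b0; apply: nondecreasing_series => n _ _.
  by rewrite mulr_ge0 ?rb_ge0 ?exprn_ge0.
apply: nondecreasing_is_cvgn; first exact: nn.
(* Dropping the nonnegative boundary term in [pseries_rb_telescope] for [a - 1] bounds [1 - x] times
   the partial sum for [a]. *)
exists ((1 - x)^-1 * limn (pseries (rb (a - 1)) x)) => _ [n _ <-].
apply: le_trans (nn _ a0 _ _ (leqnSn n)) _.
rewrite -[leLHS](mulKf (_ : 1 - x != 0)) ?subr_eq0 ?gt_eqF //.
rewrite ler_wpM2l ?invr_ge0 ?subr_ge0 ?(ltW x1) //.
apply: le_trans (nondecreasing_cvgn_le (nn _ _) c1 n.+1); last by rewrite subr_gt0.
rewrite /pseries /series /= (pseries_rb_telescope (a - 1)) subrK lerDl mulr_ge0 ?exprn_ge0 //.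
exact: rb_ge0.
Qed.

Lemma lim_pseries_rb_addr1 a x : 0 < a -> 0 <= x -> x < 1 ->
  (1 - x) * limn (pseries (rb (a + 1)) x) = limn (pseries (rb a) x).
Proof.
move=> a0 x0 x1; have a10 : 0 < a + 1 by rewrite addr_gt0.
apply/esym/cvg_lim => //.
rewrite -cvg_shiftS /= [X in X @ _ --> _](_ : _ = (fun n =>
  (1 - x) * pseries (rb (a + 1)) x n.+1 + x * (rb (a + 1) n * x ^+ n))); last first.
  by apply/funext => n; rewrite /pseries /series /= pseries_rb_telescope exprS; ring.
have c1 := is_cvg_pseries_rb a10 x0 x1.
set L := (1 - x) * limn _; rewrite -[L]addr0; apply: cvgD.
  by apply: cvgMl_tmp; rewrite (cvg_shiftS (pseries (rb (a + 1)) x)).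
have := cvgMl_tmp (a := x) (cvg_series_cvg_0 c1); rewrite mulr0; exact.
Qed.

Lemma pseries_diffs_rb a : pseries_diffs (rb a) = (fun n => a * rb (a + 1) n).
Proof. by apply/funext => n; rewrite /pseries_diffs rbS_shift. Qed.

Lemma pseriesZ (f : nat -> R) c x :
  pseries (fun n => c * f n) x = c *: pseries f x.
Proof.
apply/funext => n; rewrite [RHS](_ : _ = c * \sum_(0 <= i < n) f i * x ^+ i) // mulr_sumr.
by apply: eq_bigr => i _; rewrite mulrA.
Qed.

Lemma is_derive_pseries_rb a x : 0 < a -> 0 <= x -> x < 1 ->
  is_derive x 1 (fun y => limn (pseries (rb a) y)) (a * limn (pseries (rb (a + 1)) x)).
Proof.
move=> a0 x0 x1.
(* Termwise differentiation at [x] uses convergence of the series and of its first two formal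
   derivatives at a point beyond [x]; the midpoint of [x] and 1 serves. *)
pose K := (x + 1) / 2.
have xK : x < K by rewrite midf_lt.
have K1 : K < 1 by rewrite midf_lt.
have K0 : 0 <= K by rewrite (le_trans x0) // ltW.
have -> : a * limn (pseries (rb (a + 1)) x) = limn (pseries (pseries_diffs (rb a)) x).
  rewrite pseries_diffs_rb pseriesZ limZl_tmp //.
  by apply: is_cvg_pseries_rb => //; rewrite addr_gt0.
have a1 : 0 < a + 1 by rewrite addr_gt0.
apply: (@pseries_snd_diffs _ _ K).
- exact: is_cvg_pseries_rb.
- rewrite pseries_diffs_rb pseriesZ; apply: is_cvgZl_tmp.
  exact: is_cvg_pseries_rb.
- have -> : pseries_diffs (pseries_diffs (rb a)) = (fun n => (a * (a + 1)) * rb (a + 1 + 1) n).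
    rewrite pseries_diffs_rb; apply/funext => n; rewrite /pseries_diffs.
    by rewrite mulrCA rbS_shift mulrA.
  rewrite pseriesZ; apply: is_cvgZl_tmp.
  by apply: is_cvg_pseries_rb => //; rewrite addr_gt0.
- by rewrite !ger0_norm.
Qed.

(** With [F_a] the series, [F_a' = a F_(a+1)] and [F_a = (1 - x) F_(a+1)], so [F_a (1 - x)^a] has
    zero derivative; its value at 0 is 1. *)
Lemma binomial_series a b : 0 < a -> 0 < b -> b < 1 ->
  limn (pseries (rb a) b) * (1 - b) `^ a = 1.
Proof.
move=> a0 b0 b1.
pose g x : R := limn (pseries (rb a) x) * (1 - x) `^ a.
have dg x : 0 <= x -> x < 1 -> is_derive x 1 g 0.
  move=> x0 x1; have x10 : 0 < 1 - x by rewrite subr_gt0.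
  have d1 := is_derive_pseries_rb a0 x0 x1.
  have d2 : is_derive x 1 (fun y => 1 - y : R) (- 1).
    rewrite -sub0r; exact: (is_deriveB (is_derive_cst (1 : R) x 1) (is_derive_id x 1)).
  have d3 := @is_derive1_comp _ (@powR R ^~ a) (fun y => 1 - y) x _ _ (is_derive1_powR a x10) d2.
  have d4 := @is_deriveM _ _ _ _ _ _ _ _ d1 d3.
  apply: (@is_derive_eq _ _ _ _ _ _ _ _ d4).
  rewrite /GRing.scale /= -(lim_pseries_rb_addr1 a0 x0 x1) -(mulr_powRB1 (ltW x10) a0).
  ring.
have [||c _] := @MVT R g (fun=> 0) 0 b b0.
- by move=> x; rewrite in_itv /= => /andP[x0 xb]; apply: dg; [exact: ltW|exact: lt_trans b1].
- apply: continuous_in_subspaceT => x; rewrite inE /= in_itv /= => /andP[x0 xb].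
  have [dx _] := dg x x0 (le_lt_trans xb b1).
  exact/differentiable_continuous/derivable1_diffP.
rewrite mul0r -/(g b) => /eqP; rewrite subr_eq0 => /eqP ->.
rewrite /g subr0 powR1 mulr1; apply: cvg_lim => //.
(* The empty partial sum is 0; from one term on, the partial sums at 0 equal 1. *)
rewrite -cvg_shiftS [X in X @ _ --> _](_ : _ = cst 1); first exact: cvg_cst.
apply/funext => n; rewrite /pseries /series /= big_nat_recl // rb0 mulr1 big1 ?addr0 //.
by move=> i _; rewrite expr0n mulr0.
Qed.

End BinomialSeries.

(** * Mass and binomial moments of the negative binomial law *)

Section NegativeBinomial.
Context {R : realType}.
Implicit Types (a b c x : R) (n m k : nat).

Lemma meixner_measureE a b n :
  meixner_measure n a b = rb a n * b ^+ n * (1 - b) `^ a.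
Proof. by rewrite /meixner_measure /rb; ring. Qed.

Lemma meixner_measure_ge0 a b n : 0 < a -> 0 < b -> 0 <= meixner_measure n a b.
Proof.
move=> a0 b0; rewrite meixner_measureE mulr_ge0 ?powR_ge0 //.
by rewrite mulr_ge0 ?rb_ge0 ?exprn_ge0 // ltW.
Qed.

Lemma meixner_measure_sum1 a b : 0 < a -> 0 < b -> b < 1 ->
  series (fun v => meixner_measure v a b) @ \oo --> (1 : R).
Proof.
move=> a0 b0 b1; rewrite -(binomial_series a0 b0 b1).
rewrite [X in X @ _ --> _](_ : _ = (fun n => pseries (rb a) b n * (1 - b) `^ a)); last first.
  apply/funext => n; rewrite /pseries /series /= mulr_suml.
  by apply: eq_bigr => i _; rewrite meixner_measureE.
by apply: cvgMr_tmp; apply: is_cvg_pseries_rb => //; exact: ltW.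
Qed.

(** By [rb_bin], shifting [v] by [k] turns the weighted law into the law of parameter [a + k] times
    [rb a k (b / (1 - b))^k]. *)
Lemma meixner_measure_bin a b k : 0 < a -> 0 < b -> b < 1 ->
  series (fun v => meixner_measure v a b * 'C(v, k)%:R) @ \oo -->
    rb a k * (b^-1 - 1) ^- k.
Proof.
move=> a0 b0 b1; have b10 : 0 < 1 - b by rewrite subr_gt0.
have ak : 0 < a + k%:R by rewrite ltr_wpDr.
rewrite -(cvg_shiftn k).
rewrite [X in X @ _ --> _](_ : _ = (fun n => (rb a k * (b^-1 - 1) ^- k) *
    series (fun v => meixner_measure v (a + k%:R) b) n)); last first.
  apply/funext => n; rewrite /series /= mulr_sumr.
  rewrite (@big_cat_nat _ _ _ k) ?leq_addl //= big1_seq ?add0r; last first.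
    move=> v /andP[_]; rewrite mem_index_iota => /andP[_ vk].
    by rewrite bin_small // mulr0.
  rewrite -{1}[k]add0n big_addn addnK; apply: eq_bigr => v _.
  rewrite !meixner_measureE powRD ?(gt_eqF b10) ?implybT // powR_mulrn ?ltW //.
  have := rb_bin a (leq_addl v k); rewrite addnK => e.
  transitivity (rb a (v + k) * 'C(v + k, k)%:R * b ^+ (v + k) * (1 - b) `^ a); first by ring.
  rewrite e exprD -exprVn.
  have -> : b^-1 - 1 = (1 - b) / b by field; rewrite gt_eqF.
  rewrite exprVn expr_div_n; field.
  by rewrite !expf_neq0 // gt_eqF.
have := cvgMl_tmp (a := rb a k * (b^-1 - 1) ^- k) (meixner_measure_sum1 ak b0 b1).
by rewrite mulr1; exact.
Qed.

End NegativeBinomial.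

(** * Negative binomial means of Meixner polynomials *)

Section NegativeBinomialMean.
Context {R : realType}.
Implicit Types (a b c l : R) (f g : nat -> R) (n m k v w x y z : nat).

(** A relation rather than a value, so that convergence is carried along with the limit. *)
Definition nb_mean a b f l :=
  series (fun v => meixner_measure v a b * f v) @ \oo --> l.

Lemma cvg_ord_sum n (u : 'I_n -> nat -> R) (s : 'I_n -> R) :
  (forall i, u i @ \oo --> s i) ->
  (fun N => \sum_i u i N) @ \oo --> \sum_i s i.
Proof. by move=> us; apply: cvg_big => // ; exact: add_continuous. Qed.

Lemma eq_nb_mean a b f g l : f =1 g -> nb_mean a b f l -> nb_mean a b g l.
Proof. by move=> /funext ->. Qed.

Lemma nb_mean_unique a b f l l' : nb_mean a b f l -> nb_mean a b f l' -> l = l'.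
Proof. by move=> h h'; apply: (cvg_unique _ h h'). Qed.

Lemma nb_meanZ a b c f l : nb_mean a b f l -> nb_mean a b (fun v => c * f v) (c * l).
Proof.
move=> fl; rewrite /nb_mean [X in X @ _ --> _](_ : _ = (fun n => c *
  series (fun v => meixner_measure v a b * f v) n)); last first.
  by apply/funext => n; rewrite /series /= mulr_sumr; apply: eq_bigr => v _; rewrite mulrCA.
exact: cvgMl_tmp.
Qed.

Lemma nb_mean_sum a b n (F : 'I_n -> nat -> R) (s : 'I_n -> R) :
  (forall i, nb_mean a b (F i) (s i)) ->
  nb_mean a b (fun v => \sum_i F i v) (\sum_i s i).
Proof.
move=> Fs; rewrite /nb_mean [X in X @ _ --> _](_ : _ = (fun n =>
  \sum_i series (fun v => meixner_measure v a b * F i v) n)).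
  exact: cvg_ord_sum.
apply/funext => N; rewrite /series /= exchange_big /=.
by apply: eq_bigr => v _; rewrite mulr_sumr.
Qed.

Lemma nb_mean_hahn a b a' b' n (F : nat -> nat -> R) (s : nat -> R) :
  (forall z, (z <= n)%N -> nb_mean a b (F z) (s z)) ->
  nb_mean a b (fun v => hahn_avg a' b' n (fun z => F z v)) (hahn_avg a' b' n s).
Proof.
move=> Fs; apply: nb_mean_sum => z; apply: nb_meanZ; apply: Fs.
by rewrite -ltnS.
Qed.

(** The binomial moments cancel the powers of [b^-1 - 1], leaving the sum of [rb_sub] for [rb 0 i],
    the coefficient of [t^i] in [(1 - t)^0]. *)
Lemma nb_mean_meixner_scaled a b i : 0 < a -> 0 < b -> b < 1 ->
  nb_mean a b (meixner_scaled (b^-1 - 1) a i) (i == 0%N)%:R.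
Proof.
move=> a0 b0 b1.
have c0 : b^-1 - 1 != 0 by rewrite subr_eq0 invr_eq1 lt_eqF.
have -> : (i == 0%N)%:R = rb 0 i :> R.
  case: i => [|i]; first by rewrite rb0.
  by rewrite /rb /poch big_ord_recl addr0 mul0r mul0r.
rewrite (rb_sub a); apply: nb_mean_sum => k.
have := nb_meanZ (c := (- (b^-1 - 1)) ^+ k * rb (a + k%:R) (i - k)) (meixner_measure_bin (k := k) a0 b0 b1).
rewrite [X in nb_mean _ _ _ X -> _](_ : _ = (-1) ^+ k * rb a k * rb (0 + a + k%:R) (i - k)).
  by apply: eq_nb_mean => v; ring.
rewrite add0r (exprNn (b^-1 - 1)); move: c0; set c := b^-1 - 1 => c0; field.
exact: expf_neq0.
Qed.

(** [meixner_scaledD] separates [w] from [v], and only the degree-zero factor in [v] has nonzero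
    mean. *)
Lemma nb_mean_meixner_scaledD a1 a2 b j w : 0 < a2 -> 0 < b -> b < 1 ->
  nb_mean a2 b (fun v => meixner_scaled (b^-1 - 1) (a1 + a2) j (w + v))
    (meixner_scaled (b^-1 - 1) a1 j w).
Proof.
move=> a20 b0 b1.
have -> : meixner_scaled (b^-1 - 1) a1 j w =
   \sum_(i < j.+1) meixner_scaled (b^-1 - 1) a1 (j - i) w * ((i : nat) == 0%N)%:R.
  rewrite big_ord_recl big1 ?addr0 ?subn0 ?mulr1 // => i _.
  by rewrite mulr0.
apply: (@eq_nb_mean _ _ (fun v => \sum_(i < j.+1)
   meixner_scaled (b^-1 - 1) a1 (j - i) w * meixner_scaled (b^-1 - 1) a2 i v)).
  by move=> v; rewrite meixner_scaledD.
by apply: nb_mean_sum => i; apply: nb_meanZ; exact: nb_mean_meixner_scaled.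
Qed.

End NegativeBinomialMean.

(** * The transition: eigenvalues, detailed balance and exchange of sums *)

Section Transition.
Context {R : realType}.
Context (a1 b1 a2 b : R).
Context (a10 : 0 < a1) (b10 : 0 < b1) (a20 : 0 < a2) (b0 : 0 < b) (blt1 : b < 1).
Implicit Types (f g : nat -> R) (n m k v w x y z N M : nat).

Let a12 : 0 < a1 + b1. Proof. exact: addr_gt0. Qed.
Let ba2 : 0 < b1 + a2. Proof. exact: addr_gt0. Qed.

(* The mean of [f] after a step from [x], given [z1 = x + v]. *)
Definition step_avg x f v : R :=
  hahn_avg a1 b1 x (fun z => hahn_avg b1 a2 (x - z + v) (fun u => f (z + u)%N)).

Lemma step_avgZ x c f v : step_avg x (fun y => c * f y) v = c * step_avg x f v.
Proof.
rewrite -hahn_avgZ; apply: eq_hahn_avg => z _.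
by rewrite hahn_avgZ.
Qed.

Lemma step_avg_sum x n (F : 'I_n -> nat -> R) v :
  step_avg x (fun y => \sum_i F i y) v = \sum_i step_avg x (F i) v.
Proof.
rewrite -hahn_avg_sum; apply: eq_hahn_avg => z _.
by rewrite -hahn_avg_sum.
Qed.

Lemma step_avg_meixner_poly x n :
  nb_mean a2 b (step_avg x (fun y => meixner_poly n y (a1 + b1) b))
    (kappa a1 b1 a2 n * meixner_poly n x (a1 + b1) b).
Proof.
have rn : rb (a1 + b1) n != 0 by exact: rb_neq0.
pose c := b^-1 - 1.
suff main : nb_mean a2 b (step_avg x (meixner_scaled c (a1 + b1) n))
    (rb (a1 + b1) n * (kappa a1 b1 a2 n * meixner_poly n x (a1 + b1) b)).
  have := nb_meanZ (c := (rb (a1 + b1) n)^-1) main.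
  rewrite mulKf //; apply: eq_nb_mean => v /=.
  rewrite -step_avgZ; congr step_avg; apply/funext => y.
  by rewrite meixner_scaledE // mulKf.
rewrite mulrA -kappaE // mulr_suml.
(* [hahn_avg_meixner2] read backwards presents the limit as a Hahn mean over [z], so that each [z]
   can be treated alone. *)
have -> : \sum_(j < n.+1) rb a1 (n - j) * rb b1 j * (rb b1 j / rb (b1 + a2) j) *
     meixner_poly n x (a1 + b1) b =
   hahn_avg a1 b1 x (fun z => \sum_(j < n.+1)
     (rb b1 j / rb (b1 + a2) j * meixner_scaled c a1 (n - j) z) * meixner_scaled c b1 j (x - z)).
  rewrite hahn_avg_sum; apply: eq_bigr => j _.
  rewrite mulrAC -(@hahn_avg_meixner2 _ b) -1?ltnS // mulrC -hahn_avgZ.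
  by apply: eq_hahn_avg => z _; rewrite mulrA.
apply: nb_mean_hahn => z _.
apply: (@eq_nb_mean _ _ _ (fun v => \sum_(j < n.+1)
  (rb b1 j / rb (b1 + a2) j * meixner_scaled c a1 (n - j) z) *
   meixner_scaled c (b1 + a2) j (x - z + v))).
  move=> v; under [RHS]eq_hahn_avg => u _ do rewrite meixner_scaledD.
  rewrite hahn_avg_sum; apply: eq_bigr => j _.
  by rewrite hahn_avgZ hahn_avg_meixner_scaled //; ring.
by apply: nb_mean_sum => j; apply: nb_meanZ; exact: nb_mean_meixner_scaledD.
Qed.

(** Binomials span the Meixner polynomials and are nonnegative, which lets [kernelK_series_ge0]
    apply to them; only the existence of the mean matters. *)
Lemma step_avg_bin x k :
  exists l, nb_mean a2 b (step_avg x (fun y => 'C(y, k)%:R)) l.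
Proof.
(* Vandermonde splits ['C(z + u, k)] before the mean over [u], then the resulting binomial in
   [x - z + v] before the mean over [v]. *)
pose s z := \sum_(i < k.+1) ('C(z, i)%:R * (rb b1 (k - i) / rb (b1 + a2) (k - i))) *
  \sum_(m < (k - i).+1) 'C(x - z, m)%:R * (rb a2 (k - i - m) * (b^-1 - 1) ^- (k - i - m)).
exists (hahn_avg a1 b1 x s); apply: nb_mean_hahn => z _.
apply: (@eq_nb_mean _ _ _ (fun v => \sum_(i < k.+1)
  ('C(z, i)%:R * (rb b1 (k - i) / rb (b1 + a2) (k - i))) *
  \sum_(m < (k - i).+1) 'C(x - z, m)%:R * 'C(v, k - i - m)%:R)).
  move=> v; under [RHS]eq_hahn_avg => u _ do rewrite bin_add.
  rewrite hahn_avg_sum; apply: eq_bigr => i _.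
  by rewrite hahn_avgZ hahn_avg_bin1 // bin_add; ring.
apply: nb_mean_sum => i; apply: nb_meanZ.
apply: nb_mean_sum => m; apply: nb_meanZ.
exact: meixner_measure_bin.
Qed.

Lemma inner_psum_nd x y z : nondecreasing_seq (inner_psum b1 a2 b x y z).
Proof.
apply: nondecreasing_series => n _ _.
by rewrite mulr_ge0 ?hahn_measure_ge0 ?meixner_measure_ge0.
Qed.

Lemma meixner_psum_le1 y m n : (y <= m)%N ->
  \sum_(m <= i < n) meixner_measure (i - y) a2 b <= 1.
Proof.
move=> ym; have [nm|mn] := leqP n m; first by rewrite big_geq.
have nd : nondecreasing_seq (series (fun v => meixner_measure v a2 b)).
  by apply: nondecreasing_series => i _ _; exact: meixner_measure_ge0.
have s1 := meixner_measure_sum1 a20 b0 blt1.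
have := nondecreasing_cvgn_le nd (cvgP _ s1) (n - y)%N.
rewrite (cvg_lim _ s1) //; apply: le_trans.
apply: (@le_trans _ _ (\sum_(y <= i < n) meixner_measure (i - y) a2 b)).
  rewrite (@big_cat_nat _ _ _ m y n) //=; last exact: ltnW.
  by rewrite lerDr; apply: sumr_ge0 => i _; exact: meixner_measure_ge0.
rewrite -{1}[y]add0n big_addn /series /= le_eqVlt; apply/orP; left; apply/eqP.
by apply: eq_bigr => i _; rewrite addnK.
Qed.

Lemma inner_psum_cvg x y z : cvgn (inner_psum b1 a2 b x y z).
Proof.
apply: nondecreasing_is_cvgn; first exact: inner_psum_nd.
exists 1 => _ [N _ <-].
apply: le_trans (meixner_psum_le1 N (leq_maxr x y)).
apply: ler_sum => i _; rewrite ler_piMl ?meixner_measure_ge0 //.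
exact: hahn_measure_le1.
Qed.

Lemma inner_lim_ge0 x y z : 0 <= limn (inner_psum b1 a2 b x y z).
Proof.
have := nondecreasing_cvgn_le (@inner_psum_nd x y z) (@inner_psum_cvg x y z) 0%N.
by apply: le_trans; rewrite /inner_psum big_geq.
Qed.

Lemma kernelK_ge0 x y : 0 <= kernelK a1 b1 a2 b x y.
Proof.
by apply: sumr_ge0 => z _; rewrite mulr_ge0 ?hahn_measure_ge0 ?inner_lim_ge0.
Qed.

(** The symmetry already holds for each [z1], since [b ^+ y * b ^+ (z1 - y) = b ^+ z1]. *)
Lemma inner_lim_sym x y z : (z <= minn x y)%N ->
  rb b1 (y - z) * b ^+ y * limn (inner_psum b1 a2 b x y z) =
  rb b1 (x - z) * b ^+ x * limn (inner_psum b1 a2 b y x z).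
Proof.
move=> zxy; set cl := rb _ _ * _; set cr := rb _ (x - z) * _.
have hl := cvgMl_tmp (a := cl) (@inner_psum_cvg x y z).
have hr := cvgMl_tmp (a := cr) (@inner_psum_cvg y x z).
rewrite -(cvg_lim (@Rhausdorff R) (hl _)); apply: cvg_lim => //.
rewrite [X in X @ _ --> _](_ : _ = (fun N => cr * inner_psum b1 a2 b y x z N)); first exact: hr.
apply/funext => N; rewrite /inner_psum !mulr_sumr maxnC.
rewrite big_nat_cond [RHS]big_nat_cond; apply: eq_bigr => i /andP[/andP[yxi _] _].
rewrite !hahn_measureE //; [|by lia..].
rewrite !meixner_measureE /cl /cr.
have -> : (i - z - (x - z) = i - x)%N by lia.
have -> : (i - z - (y - z) = i - y)%N by lia.
transitivity (rb b1 (y - z) * rb b1 (x - z) * rb a2 (i - x) * rb a2 (i - y) /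
  rb (b1 + a2) (i - z) * (1 - b) `^ a2 * (b ^+ y * b ^+ (i - y))); first by ring.
transitivity (rb b1 (y - z) * rb b1 (x - z) * rb a2 (i - x) * rb a2 (i - y) /
  rb (b1 + a2) (i - z) * (1 - b) `^ a2 * (b ^+ x * b ^+ (i - x))); last by ring.
by rewrite -!exprD !subnKC //; lia.
Qed.

(** The Hahn normaliser [rb (a1 + b1) y] cancels against the Meixner weight, leaving for each [z]
    the prefactor of [inner_lim_sym]. *)
Lemma kernelK_balance x y :
  kernelK a1 b1 a2 b x y * meixner_measure y (a1 + b1) b =
  kernelK a1 b1 a2 b y x * meixner_measure x (a1 + b1) b.
Proof.
rewrite /kernelK [minn y x]minnC !mulr_suml.
rewrite big_nat_cond [RHS]big_nat_cond; apply: eq_bigr => z /andP[/andP[_ zxy] _].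
rewrite !hahn_measureE //; [|by lia..].
rewrite !meixner_measureE.
have ry := rb_neq0 y a12; have rx := rb_neq0 x a12.
transitivity (rb a1 z * (1 - b) `^ (a1 + b1) *
  (rb b1 (y - z) * b ^+ y * limn (inner_psum b1 a2 b x y z))); first by field.
by rewrite inner_lim_sym //; field.
Qed.

(** In [kernelK y x] the step starts from [x]. Truncating to [y < N] and [z1 < M] gives finite sums,
    which can be reordered. *)
Definition kernel_psum x f N M : R :=
  \sum_(0 <= y < N) (\sum_(0 <= z < (minn y x).+1)
    hahn_measure z x a1 b1 * inner_psum b1 a2 b y x z M) * f y.

Lemma kernel_psum_cvg x f N :
  (fun M => kernel_psum x f N M) @ \oo -->
    series (fun y => kernelK a1 b1 a2 b y x * f y) N.
Proof.
rewrite /kernel_psum /series /= big_mkord.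
under eq_fun => M do rewrite big_mkord.
apply: cvg_ord_sum => y; apply: cvgMr_tmp.
rewrite /kernelK big_mkord; under eq_fun => M do rewrite big_mkord.
apply: cvg_ord_sum => z; apply: cvgMl_tmp.
exact: inner_psum_cvg.
Qed.

Lemma kernel_psum_nd x f N : (forall y, 0 <= f y) ->
  nondecreasing_seq (kernel_psum x f N).
Proof.
move=> f0 m n mn; apply: ler_sum => y _; rewrite ler_wpM2r //.
apply: ler_sum => z _; rewrite ler_wpM2l ?hahn_measure_ge0 //.
exact: inner_psum_nd.
Qed.

Lemma kernel_psum_le x f N M : (forall y, 0 <= f y) -> (N <= M)%N ->
  kernel_psum x f N M <= kernel_psum x f M M.
Proof.
move=> f0 NM; rewrite /kernel_psum [leRHS](@big_cat_nat _ _ _ N) //=.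
rewrite lerDl; apply: sumr_ge0 => y _; rewrite mulr_ge0 //.
apply: sumr_ge0 => z _; rewrite mulr_ge0 ?hahn_measure_ge0 //.
by apply: sumr_ge0 => i _; rewrite mulr_ge0 ?hahn_measure_ge0 ?meixner_measure_ge0.
Qed.

(** As [y <= z1], the bound [z1 < N] implies [y < N]; with [z1 = x + v] outermost, the sums over [z]
    and [y] are therefore complete Hahn means. *)
Lemma kernel_psum_diag x f N :
  kernel_psum x f N N =
  series (fun v => meixner_measure v a2 b * step_avg x f v) (N - x)%N.
Proof.
(* The summand is extended by 0 to a full box, where sums can be exchanged. *)
pose t y z i := if [&& (z <= y)%N & (maxn y x <= i)%N] then
  hahn_measure z x a1 b1 * (hahn_measure (y - z) (i - z) b1 a2 *
    meixner_measure (i - x) a2 b) * f y else 0.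
transitivity (\sum_(0 <= y < N) \sum_(0 <= z < x.+1) \sum_(0 <= i < N) t y z i).
  apply: eq_bigr => y _; rewrite mulr_suml.
  rewrite (@big_nat_widen _ _ _ 0 _ x.+1) ?ltnS ?geq_minr // big_mkcond /=.
  rewrite big_nat_cond [RHS]big_nat_cond; apply: eq_bigr => z /andP[/andP[_ zx] _].
  rewrite ltnS leq_min -ltnS -(ltnS z x) zx andbT ltnS /t.
  case: (z <= y)%N; last by rewrite big1.
  rewrite /inner_psum (@big_nat_widenl _ _ _ _ 0) // mulr_sumr mulr_suml.
  by rewrite big_mkcond.
transitivity (\sum_(0 <= i < N) \sum_(0 <= z < x.+1) \sum_(0 <= y < N) t y z i).
  under eq_bigr => y _ do rewrite exchange_big.
  by rewrite exchange_big; apply: eq_bigr => i _; rewrite exchange_big.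
have step i : (x <= i)%N -> (i < N)%N ->
    \sum_(0 <= z < x.+1) \sum_(0 <= y < N) t y z i =
    meixner_measure (i - x) a2 b * step_avg x f (i - x).
  move=> xi iN; rewrite /step_avg hahn_avgE // mulr_sumr.
  rewrite big_nat_cond [RHS]big_nat_cond; apply: eq_bigr => z /andP[/andP[_ zx] _].
  have -> : (x - z + (i - x) = i - z)%N by lia.
  transitivity (\sum_(z <= y < i.+1) t y z i).
    rewrite (@big_cat_nat _ _ _ z) //=; last by lia.
    rewrite big1_seq ?add0r; last first.
      move=> y; rewrite mem_index_iota => /andP[_ /andP[_ yz]].
      by rewrite /t leqNgt yz.
    rewrite (@big_cat_nat _ _ _ i.+1) //=; last by lia.
    rewrite [X in _ + X]big1_seq ?addr0 //.
    move=> y; rewrite mem_index_iota => /andP[_ /andP[iy _]].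
    by rewrite /t geq_max (leqNgt y i) iy /= andbF.
  rewrite hahn_avgE // mulr_sumr mulr_sumr -{1}[z]add0n big_addn subSn; last by lia.
  rewrite big_nat_cond [RHS]big_nat_cond; apply: eq_bigr => u /andP[/andP[_ uz] _].
  rewrite /t leq_addl geq_max xi andbT.
  have -> : (u + z <= i)%N by lia.
  by rewrite addnK [(u + z)%N]addnC; ring.
have [Nx|xN] := leqP N x.
  rewrite (eqP (_ : N - x == 0)%N) ?subn_eq0 // /series /= [RHS]big_geq //.
  rewrite big1_seq // => i /andP[_]; rewrite mem_index_iota => /andP[_ iN].
  rewrite big1 // => z _; rewrite big1 // => y _.
  by rewrite /t geq_max (leqNgt x i) (leq_trans iN Nx) !andbF.
rewrite (@big_cat_nat _ _ _ x) //=; last exact: ltnW.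
rewrite big1_seq ?add0r; last first.
  move=> i /andP[_]; rewrite mem_index_iota => /andP[_ ix].
  rewrite big1 // => z _; rewrite big1 // => y _.
  by rewrite /t geq_max (leqNgt x i) ix !andbF.
rewrite -{1}[x]add0n big_addn /series /=.
rewrite big_nat_cond [RHS]big_nat_cond; apply: eq_bigr => v /andP[/andP[_ vN] _].
by rewrite step ?leq_addl ?addnK //; lia.
Qed.

(* The partial sums of the left-hand series lie between the partial sums of the
   negative binomial mean and its value [l], because a jump from [x] to [y]
   passes through some [z1 >= y]. *)
Lemma kernelK_series_ge0 x f l : (forall y, 0 <= f y) ->
  nb_mean a2 b (step_avg x f) l ->
  series (fun y => kernelK a1 b1 a2 b y x * f y) @ \oo --> l.
Proof.
move=> f0 fl.
have flx : (fun N => kernel_psum x f N N) @ \oo --> l.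
  rewrite (_ : (fun N => _) =
    [sequence series (fun v => meixner_measure v a2 b * step_avg x f v) (N - x)%N]_N).
    by rewrite cvg_centern.
  by apply/funext => N; exact: kernel_psum_diag.
have ndd : nondecreasing_seq (fun N => kernel_psum x f N N).
  move=> m n mn; apply: le_trans (kernel_psum_nd x m f0 mn) _.
  exact: kernel_psum_le.
have dl N : kernel_psum x f N N <= l.
  by have := nondecreasing_cvgn_le ndd (cvgP _ flx) N; rewrite (cvg_lim _ flx).
apply: (@squeeze_cvgr _ _ _ _ (fun N => kernel_psum x f N N) (fun=> l)) => //; last exact: cvg_cst.
apply: nearW => N; have c := @kernel_psum_cvg x f N.
(* The partial sum is the limit in [M] of [kernel_psum x f N M]: at least its value at [M = N], and
   at most [l] since for [M >= N] the diagonal value at [M] dominates. *)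
rewrite -(cvg_lim (@Rhausdorff R) c); apply/andP; split.
  exact: (nondecreasing_cvgn_le (kernel_psum_nd x N f0) (cvgP _ c)).
apply: limr_le; first exact: cvgP c.
by exists N => // M /= NM; apply: le_trans (dl M); exact: kernel_psum_le.
Qed.

(** Meixner polynomials can change sign, so the monotone argument is applied to each binomial;
    uniqueness of limits identifies the combined value. *)
Lemma kernelK_meixner_poly x n :
  series (fun y => kernelK a1 b1 a2 b y x * meixner_poly n y (a1 + b1) b) @ \oo -->
  kappa a1 b1 a2 n * meixner_poly n x (a1 + b1) b.
Proof.
have [s hs] := boolp.choice (step_avg_bin x).
pose r k : R := 'C(n, k)%:R * (1 - b^-1) ^+ k / rb (a1 + b1) k.
have PE y : meixner_poly n y (a1 + b1) b = \sum_(k < n.+1) r k * 'C(y, k)%:R.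
  by rewrite meixner_polyE //; apply: eq_bigr => k _; rewrite /r mulrAC.
rewrite (@nb_mean_unique _ a2 b _ _ (\sum_(k < n.+1) r k * s k) (@step_avg_meixner_poly x n)).
  rewrite [X in X @ _ --> _](_ : _ = (fun N => \sum_(k < n.+1) r k *
     series (fun y => kernelK a1 b1 a2 b y x * 'C(y, k)%:R) N)).
    apply: cvg_ord_sum => k; apply: cvgMl_tmp.
    by apply: kernelK_series_ge0 => // y; rewrite ler0n.
  apply/funext => N; rewrite /series /=.
  under [RHS]eq_bigr => k _ do rewrite mulr_sumr.
  rewrite exchange_big /=; apply: eq_bigr => y _.
  by rewrite PE mulr_sumr; apply: eq_bigr => k _; rewrite mulrCA.
apply: (@eq_nb_mean _ _ _ (fun v => \sum_(k < n.+1) r k * step_avg x (fun y => 'C(y, k)%:R) v)).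
  move=> v; rewrite (_ : (fun y => _) = (fun y => \sum_(k < n.+1) r k * 'C(y, k)%:R)).
    by rewrite step_avg_sum; apply: eq_bigr => k _; rewrite step_avgZ.
  by apply/funext.
by apply: nb_mean_sum => k; exact: nb_meanZ.
Qed.

End Transition.

Theorem mainTheorem16 (R : realType) (a1 b1 a2 b2 : R)
    (ha1 : 0 < a1) (hb1 : 0 < b1) (ha2 : 0 < a2)
    (hb2_gt0 : 0 < b2) (hb2_lt1 : b2 < 1) :
  let K := kernelK a1 b1 a2 b2 in
  let piM := fun x : nat => meixner_measure x (a1 + b1) b2 in
  let P := fun n x : nat => meixner_poly n x (a1 + b1) b2 in
  (forall x y z2 : nat, (z2 <= minn x y)%N ->
     cvgn (inner_psum b1 a2 b2 x y z2)) /\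
  (forall x y : nat, 0 <= K x y) /\
  (forall y : nat, series (fun x : nat => K x y) @ \oo --> (1 : R)) /\
  (forall x y : nat, K x y * piM y = K y x * piM x) /\
  (forall x n : nat,
     series (fun y : nat => K x y * piM y * P n y) @ \oo
       --> kappa a1 b1 a2 n * piM x * P n x).
Proof.
move=> K piM P; have hab : 0 < a1 + b1 by exact: addr_gt0.
have sym x y : K x y * piM y = K y x * piM x by exact: kernelK_balance.
split; first by move=> x y z _; exact: inner_psum_cvg.
split; first by move=> x y; exact: kernelK_ge0.
split; last split=> // x n.
  move=> y; have := @kernelK_meixner_poly R a1 b1 a2 b2 ha1 hb1 ha2 hb2_gt0 hb2_lt1 y 0.
  have P0 x : meixner_poly 0 x (a1 + b1) b2 = 1.
    by rewrite meixner_polyE // big_ord1 rb0 !bin0 !mulr1 divr1.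
  have k0 : kappa a1 b1 a2 0 = 1 by rewrite /kappa big_nat1 !poch0 fact0 !mulr1 divr1.
  by rewrite P0 k0 mulr1; under [X in series X]eq_fun => x do rewrite P0 mulr1.
(* Detailed balance replaces [K x y * piM y] by [K y x * piM x], so [piM x] factors out. *)
rewrite [X in X @ _ --> _](_ : _ = (fun N => piM x *
    series (fun y => kernelK a1 b1 a2 b2 y x * meixner_poly n y (a1 + b1) b2) N)).
  by rewrite mulrAC mulrC; apply: cvgMl_tmp; exact: kernelK_meixner_poly.
apply/funext => N; rewrite /series /= mulr_sumr; apply: eq_bigr => y _.
by rewrite sym /P -mulrA mulrCA.
Qed.
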